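(* Fix a prime power $q$ and an integer $t\ge 2$ (so $d=2t\ge 4$), and assume $n\ge 7t+5$. Let $V=\mathbb F_q^n$ and let $\mathcal F$ be a family of subspaces of $V$ with $\mathrm{diam}(\mathcal F)\le 2t$ such that $\mathcal F\not\subseteq\mathcal L_t$ and $\mathcal F\not\subseteq\mathcal U_t$, where $\mathcal L_t=\bigcup_{k=0}^{t}\mathcal V(k)$ and $\mathcal U_t=\bigcup_{k=n-t}^{n}\mathcal V(k)$. Then \[ |\mathcal F|\le\sum_{i=0}^{t-1}\begin{bmatrix} n\\ i\end{bmatrix}_q+\begin{bmatrix} n-1\\ t-1\end{bmatrix}_q+\begin{bmatrix} n-1\\ t\end{bmatrix}_q. \] Moreover, equality holds if and only if there exists a $1$-dimensional subspace $X$ of $V$ such that $\mathcal F=\mathcal B(X,t)$ or $\mathcal F^\perp=\mathcal B(X,t)$.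
   Context: $V=\mathbb F_q^n$; $\mathcal V$ is the set of all subspaces of $V$ and $\mathcal V(k)$ the set of $k$-dimensional subspaces; $\begin{bmatrix} n\\ k\end{bmatrix}_q=|\mathcal V(k)|=\prod_{i=0}^{k-1}\frac{q^{n-i}-1}{q^{k-i}-1}$. For subspaces $U,W$, $\Delta(U,W)=\dim(U+W)-\dim(U\cap W)$; $\mathrm{diam}(\mathcal F)=\max\{\Delta(U,W):U,W\in\mathcal F\}$. For $C\in\mathcal V$ and $r\ge0$, $\mathcal B(C,r)=\{A\in\mathcal V:\Delta(A,C)\le r\}$. $U^\perp$ is the orthogonal complement with respect to a fixed nondegenerate bilinear form on $V$, and $\mathcal F^\perp=\{U^\perp:U\in\mathcal F\}$. *)

(* Defs.v *)
From HB Require Import structures.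
From mathcomp Require Import all_boot all_order all_algebra.

Set Implicit Arguments.
Unset Strict Implicit.
Unset Printing Implicit Defensive.

Import Order.TTheory GRing.Theory Num.Theory.
Local Open Scope ring_scope.

HB.instance Definition _ (K : finFieldType) (vT : vectType K) :
    isCountable {vspace vT} :=
  CanIsCountable (@VectorInternalTheory.vs2mxK K vT).
HB.instance Definition _ (K : finFieldType) (vT : vectType K) :
    isFinite {vspace vT} :=
  CanIsFinite (@VectorInternalTheory.vs2mxK K vT).

(* The factors are taken in rat, so that each quotient is a true division. *)
Definition qbinom (q n k : nat) : rat :=
  \prod_(i < k) ((q%:R ^+ (n - i) - 1) / (q%:R ^+ (k - i) - 1)).

Section Subspaces.
Variables (K : finFieldType) (n : nat).
Local Notation V := 'rV[K]_n.
Implicit Types (U W C : {vspace V}) (Fam : {set {vspace V}}).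

Definition subspaces_of_dim (k : nat) : {set {vspace V}} :=
  [set U | \dim U == k].

Definition subspaces_low (t : nat) : {set {vspace V}} :=
  \bigcup_(0 <= k < t.+1) subspaces_of_dim k.

Definition subspaces_high (t : nat) : {set {vspace V}} :=
  \bigcup_(n - t <= k < n.+1) subspaces_of_dim k.

(* The truncated subtraction is exact, as U :&: W is contained in U + W. *)
Definition sdist U W : nat := (\dim (U + W) - \dim (U :&: W))%N.

(* The diameter of the empty family is 0. *)
Definition diam Fam : nat := \max_(U in Fam) \max_(W in Fam) sdist U W.

Definition sball C (r : nat) : {set {vspace V}} := [set A | (sdist A C <= r)%N].

(* In finite dimension, triviality of the left radical is equivalent to
   triviality of the right one. *)
Definition nondegenerate_form (B : {biscalar V}) : Prop :=
  forall u : V, (forall v : V, B u v = 0) -> u = 0.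

(* The form need not be symmetric; perp B U is the right orthogonal
   complement, i.e. the set of v with B u v = 0 for all u in U (mem_perp). *)
Definition perp (B : {biscalar V}) U : {vspace V} :=
  (\bigcap_(u : V | u \in U) lker (linfun (B u : V -> K^o)))%VS.

Lemma mem_perp (B : {biscalar V}) U (v : V) :
  reflect {in U, forall u, B u v = 0} (v \in perp B U).
Proof.
have kerE u : (v \in lker (linfun (B u : V -> K^o))) = (B u v == 0).
  by rewrite memv_ker lfunE.
apply: (iffP idP) => [vU u uU | vU].
  apply/eqP; rewrite -kerE; apply: (subvP _ v vU).
  by rewrite /perp (bigD1 u) //= capvSl.
rewrite memvE; apply/subv_bigcapP => u uU.
by rewrite -memvE kerE vU.
Qed.

Definition perp_family (B : {biscalar V}) Fam : {set {vspace V}} :=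
  [set perp B U | U in Fam].

End Subspaces.

(* Main.v *)
Require Import Defs.
From HB Require Import structures.
From mathcomp Require Import all_boot all_order all_algebra.
From mathcomp Require Import finfield zify ring lra.
Set Implicit Arguments.
Unset Strict Implicit.
Unset Printing Implicit Defensive.
Import Order.TTheory GRing.Theory Num.Theory.
Local Open Scope ring_scope.

(** Write [[m, k]] for Gaussian binomials and [R = [n - 1, t]].  For members of
    a family of diameter at most [2 t], [dim U + dim W <= 2 dim (U :&: W) + 2 t].
    In particular the members of dimension [t + s] pairwise meet in dimension
    at least [s]: either they share an [s]-space, and there are at most
    [[n - s, t]] of them, or a two-step covering argument leaves at most
    [[t + s, s] [t + 1, 1] [n - s - 1, t - 1]].  Summed over the levels
    [s >= a] below the middle dimension this is at most
    [(2 / 4 ^ (a - 1) + 1 / 4) R].  Since orthogonal complements preserve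
    distances, levels above the middle are handled by duality, and a family all
    of whose dimensions lie in [[t + 2, n - t - 2]] has fewer than [R] members.
    Otherwise, up to duality, some member has dimension at most [t + 1] and
    some member has dimension above [t]; then all dimensions are at most
    [3 t + 1], level [t] is negligible, and level [t + 1] is negligible too
    unless the family lies in the ball around a line. *)

(** * Growth of Gaussian binomials *)

Section GaussianBinomials.
Variables (q : nat) (q_gt1 : (1 < q)%N).
Local Notation Q := (q%:R : rat).
Local Notation "[ n , k ]" := (qbinom q n k).

Lemma two_leQ : 2 <= Q. Proof. by rewrite (ler_nat _ 2). Qed.

Lemma Qexp_gt0 m : 0 < Q ^+ m.
Proof. by rewrite exprn_gt0 // ltr0n; lia. Qed.

Lemma Qexp_ge1 m : 1 <= Q ^+ m.
Proof. by rewrite exprn_ege1 // ler1n; lia. Qed.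

Lemma two_exp_leQ m : 2 ^+ m <= Q ^+ m.
Proof. by rewrite lerXn2r ?nnegrE ?ler0n // two_leQ. Qed.

Lemma QexpS_sub1_gt0 k : 0 < Q ^+ k.+1 - 1.
Proof. by rewrite subr_gt0 exprn_egt1 // ltr1n. Qed.

Lemma qbinom0 n : [n, 0] = 1.
Proof. by rewrite /qbinom big_ord0. Qed.

Lemma qbinomS n k : [n, k.+1] = (Q ^+ n - 1) / (Q ^+ k.+1 - 1) * [n.-1, k].
Proof.
rewrite /qbinom big_ord_recl !subn0; congr (_ * _).
by apply: eq_bigr => i _; rewrite lift0 subSS subnS -subn1 subnAC subn1.
Qed.

Lemma qbinom_ge0 n k : 0 <= [n, k].
Proof.
elim: k n => [|k IHk] n; first by rewrite qbinom0.
by rewrite qbinomS mulr_ge0 // divr_ge0 ?(ltW (QexpS_sub1_gt0 _)) // subr_ge0 Qexp_ge1.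
Qed.

Lemma qbinom_gt0 n k : (k <= n)%N -> 0 < [n, k].
Proof.
elim: k n => [|k IHk] [|n] //; rewrite ?qbinom0 // => le_kn.
by rewrite qbinomS mulr_gt0 ?IHk // divr_gt0 ?QexpS_sub1_gt0.
Qed.

Lemma qbinomSr n k :
  [n, k.+1] = [n, k] * ((Q ^+ (n - k) - 1) / (Q ^+ k.+1 - 1)).
Proof.
elim: k n => [|k IHk] n; first by rewrite qbinomS !qbinom0 subn0 mulr1 mul1r.
rewrite qbinomS IHk (qbinomS n k) -subn1 -subnDA add1n.
by rewrite -!mulrA; congr (_ * _); rewrite [RHS]mulrCA mulrC !mulrA; ring.
Qed.

Lemma qbinom_incr n k : Q ^+ k * [n, k] <= [n.+1, k].
Proof.
elim: k n => [|k IHk] n; first by rewrite !qbinom0 mulr1.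
case: n => [|n].
  by rewrite qbinomS expr0 subrr !mul0r mulr0 qbinom_ge0.
rewrite !qbinomS /= [X in X * _ <= _]exprS.
have -> : Q * Q ^+ k * ((Q ^+ n.+1 - 1) / (Q ^+ k.+1 - 1) * [n, k]) =
          (Q * (Q ^+ n.+1 - 1)) / (Q ^+ k.+1 - 1) * (Q ^+ k * [n, k]) by ring.
apply: ler_pM => //.
- by rewrite divr_ge0 ?(ltW (QexpS_sub1_gt0 _)) // mulr_ge0 ?ler0n // ltW ?QexpS_sub1_gt0.
- by rewrite mulr_ge0 ?qbinom_ge0 // ltW ?Qexp_gt0.
rewrite ler_pM2r ?invr_gt0 ?QexpS_sub1_gt0 // mulrBr mulr1 -exprS.
by have := two_leQ; lra.
Qed.

Lemma qbinom_incrn n k s : Q ^+ (k * s) * [n, k] <= [n + s, k].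
Proof.
elim: s => [|s IHs]; first by rewrite muln0 mul1r addn0.
rewrite mulnS exprD -mulrA addnS (le_trans _ (qbinom_incr _ _)) //.
by rewrite ler_pM2l ?Qexp_gt0.
Qed.

(** The quotient of neighbouring columns is given by [qbinomSr], and
    [(Q ^ m - 1) / (Q ^ j - 1) >= Q ^ (m - j)] whenever [0 < j <= m]. *)
Lemma qbinom_incr_col n k : (2 * k < n)%N ->
  [n, k] * Q ^+ (n - (2 * k).+1) <= [n, k.+1].
Proof.
move=> lt_kn; rewrite qbinomSr ler_wpM2l ?qbinom_ge0 //.
rewrite ler_pdivlMr ?QexpS_sub1_gt0 // mulrBr mulr1 -exprD.
have -> : (n - (2 * k).+1 + k.+1 = n - k)%N by lia.
by rewrite lerD2l lerN2 Qexp_ge1.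
Qed.

Lemma qbinom1_le m : [m.+1, 1] <= 2 * Q ^+ m.
Proof.
rewrite qbinomS qbinom0 mulr1 ler_pdivrMr ?QexpS_sub1_gt0 // expr1 exprS.
by have := Qexp_gt0 m; have := two_leQ; nra.
Qed.

(* The quarter bounds the infinite product of the [1 - 2 ^- i] from below. *)
Lemma qbinom_le4_strong s t :
  [s + t.+1, t.+1] * (1 / 4 + 1 / 2 ^+ t.+2) <= Q ^+ (s * t.+1).
Proof.
elim: t => [|t IHt].
  have := qbinom1_le s; rewrite addn1 muln1; set x := [_, _]; set y := Q ^+ s.
  by rewrite !exprS expr0; lra.
rewrite addnS qbinomS /= [(s * t.+2)%N]mulnS exprD.
have h_gt0 : 0 < 2 ^+ t.+2 :> rat by rewrite exprn_gt0.
have h_ge4 : 4 <= 2 ^+ t.+2 :> rat.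
  have : 1 <= 2 ^+ t :> rat by rewrite exprn_ege1.
  by rewrite !exprS; lra.
have Yh := two_exp_leQ t.+2; have Y_gt := QexpS_sub1_gt0 t.+1.
have Qs := Qexp_gt0 s.
rewrite -addnS exprD (exprS 2 t.+2).
move: IHt h_gt0 h_ge4 Yh Y_gt Qs (qbinom_ge0 (s + t.+1) t.+1) (Qexp_gt0 (s * t.+1)).
set g := [_, _]; set h := 2 ^+ t.+2; set Y := Q ^+ t.+2; set Z := Q ^+ s.
set W := Q ^+ _ => IH h_gt0 h_ge4 Yh Y_gt Z_gt g_ge0 W_gt0.
clearbody g h Y Z W.
have -> : 1 / (2 * h) = (1 / h) / 2 by field; lra.
have : 1 <= 1 / h * Y by rewrite mulrAC ler_pdivlMr ?mul1r.
have : 1 / h <= 1 / 4 by rewrite ler_pdivrMr ?h_gt0; lra.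
have : 0 < 1 / h by rewrite divr_gt0.
move: IH; set k := 1 / h => IH k_gt0 k_le kY; clearbody k.
rewrite (_ : _ * g * _ = (Z * Y - 1) * g * (1 / 4 + k / 2) / (Y - 1)); last by ring.
rewrite ler_pdivrMr //.
apply: (@le_trans _ _ (Z * g * ((1 / 4 + k / 2) * Y))).
  have : 0 <= g * (1 / 4 + k / 2) by apply: mulr_ge0; lra.
  by lra.
(* Halving the slack from [k] to [k / 2] pays for the factor [Y / (Y - 1)], because [1 <= k * Y] and
   [k <= 1 / 4]. *)
apply: (@le_trans _ _ (Z * g * ((1 / 4 + k) * (Y - 1)))).
  by apply: ler_wpM2l; [rewrite mulr_ge0 // ltW | lra].
rewrite [leLHS](_ : _ = Z * (Y - 1) * (g * (1 / 4 + k))); last by ring.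
rewrite [leRHS](_ : _ = Z * (Y - 1) * W); last by ring.
by rewrite ler_wpM2l // mulr_ge0 // ltW.
Qed.

Lemma qbinom_le4 s t : [s + t, t] <= 4 * Q ^+ (s * t).
Proof.
case: t => [|t]; first by rewrite qbinom0 muln0 mulr1.
have := qbinom_le4_strong s t; have := qbinom_ge0 (s + t.+1) t.+1.
have : 0 <= 1 / 2 ^+ t.+2 :> rat by rewrite divr_ge0 ?exprn_ge0.
by set x := qbinom _ _ _; set y := 1 / _; nra.
Qed.

(** The surplus [Q ^+ e] of [R] over [Y] survives multiplication by [X]. It is weakened to a power
    of 2 so that later constants do not depend on [q]. *)
Lemma mul_le_absorb (X Y R c : rat) a e e' : 0 <= Y -> 0 <= c ->
    X <= c * Q ^+ a -> Y * Q ^+ (a + e) <= R -> (e' <= e)%N ->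
  X * Y <= c * R / 2 ^+ e'.
Proof.
move=> Y_ge0 c_ge0 leX leY le_e.
rewrite ler_pdivlMr ?exprn_gt0 //.
apply: (@le_trans _ _ (c * Q ^+ a * Y * Q ^+ e)); last first.
  have -> : c * Q ^+ a * Y * Q ^+ e = c * (Y * Q ^+ (a + e)).
    by rewrite exprD; ring.
  by rewrite ler_wpM2l.
have cQ_ge0 : 0 <= c * Q ^+ a by rewrite mulr_ge0 // ltW ?Qexp_gt0.
apply: (@le_trans _ _ (c * Q ^+ a * Y * 2 ^+ e')).
  by rewrite ler_wpM2r ?exprn_ge0 // ler_wpM2r.
apply: ler_wpM2l; first by rewrite mulr_ge0.
apply: le_trans (two_exp_leQ _) _.
by rewrite ler_weXn2l // ler1n; lia.
Qed.

(** * Comparison of the counting bounds with [R] *)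

Section Estimates.
Variables (t n : nat) (t_ge2 : (2 <= t)%N) (n_ge : (7 * t + 5 <= n)%N).
Local Notation R := [(n - 1)%N, t].

(** Raising the upper index by [s] gains [Q ^+ ((t - 1) * s)]; passing from column [t - 1] to column
    [t] gains [Q ^+ (n - 2 * t)]. *)
Lemma qbinom_top_col s : (s.+1 <= n)%N ->
  [(n - s.+1)%N, (t - 1)%N] * Q ^+ ((t - 1) * s + (n - 2 * t)) <= R.
Proof.
move=> lt_sn.
have := @qbinom_incr_col (n - 1) (t - 1); rewrite (_ : (t - 1).+1 = t); last lia.
have -> : (n - 1 - (2 * (t - 1)).+1 = n - 2 * t)%N by lia.
move=> H; apply: le_trans (H _); last by lia.
rewrite exprD mulrA ler_pM2r ?Qexp_gt0 // mulrC.
have := qbinom_incrn (n - s.+1) (t - 1) s.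
by rewrite (_ : (n - s.+1 + s = n - 1)%N) //; lia.
Qed.

Lemma cover1_estimate a : (0 < a <= 3 * t + 1)%N ->
  [a, 1] * [(n - 1)%N, (t - 1)%N] <= R / 256.
Proof.
case: a => // a /= le_a.
(* Now [a <= 3 * t], so the surplus exponent is at least [2 * t + 5 >= 9], and
   [2 / 2 ^ 9 = 1 / 256]. *)
have H := @mul_le_absorb _ _ R 2 a (n - 2 * t - a) 9
  (qbinom_ge0 (n - 1) (t - 1)) isT (qbinom1_le a).
apply: (le_trans (H _ _)).
- rewrite (_ : (a + (n - 2 * t - a) = (t - 1) * 0 + (n - 2 * t))%N); last lia.
  by apply: qbinom_top_col; lia.
- by lia.
by have := qbinom_ge0 (n - 1) t; rewrite !exprS expr0; set x := [_, _]; lra.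
Qed.

Lemma cover2_estimate a : (1 < a <= 3 * t + 1)%N ->
  [a, 2] * [(n - 2)%N, (t - 1)%N] <= R / 16.
Proof.
case: a => [|[|a]] //= le_a.
have lea : [a.+2, 2] <= 4 * Q ^+ (a * 2) by rewrite -addn2 qbinom_le4.
(* Now [a <= 3 * t - 1], so [7 * t + 5 <= n] leaves a surplus exponent of at least 6, and
   [4 / 2 ^ 6 = 1 / 16]. *)
have H := @mul_le_absorb _ _ R 4 (a * 2) (n - t - 1 - a * 2) 6
  (qbinom_ge0 (n - 2) (t - 1)) isT lea.
apply: (le_trans (H _ _)).
- rewrite (_ : (a * 2 + (n - t - 1 - a * 2) = (t - 1) * 1 + (n - 2 * t))%N); last lia.
  by apply: qbinom_top_col; lia.
- by lia.
by have := qbinom_ge0 (n - 1) t; rewrite !exprS expr0; set x := [_, _]; lra.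
Qed.

(** Each unit added to the upper index gains a factor [Q ^+ t], which is at least 4 because
    [2 <= t]. *)
Lemma star_estimate s : (0 < s <= n)%N -> [(n - s)%N, t] <= R / 4 ^+ (s - 1).
Proof.
move=> s_bd; rewrite ler_pdivlMr ?exprn_gt0 // mulrC.
have := qbinom_incrn (n - s) t (s - 1).
rewrite (_ : (n - s + (s - 1) = n - 1)%N); last lia.
apply: le_trans; rewrite ler_wpM2r ?qbinom_ge0 // exprM.
rewrite lerXn2r ?nnegrE ?exprn_ge0 ?ler0n //.
apply: le_trans (two_exp_leQ t).
have -> : t = (t - 2).+2 by lia.
have : 1 <= 2 ^+ (t - 2) :> rat by rewrite exprn_ege1.
by rewrite !exprS; lra.
Qed.

(** The first two factors have order [Q ^+ (t * s + t)] with constant [4 * 2]; against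
    [qbinom_top_col] the exponent [n - 3 * t - s] remains. *)
Lemma nonstar_estimate s : (0 < s)%N -> (3 * t + s <= n)%N ->
  [(t + s)%N, s] * ([t.+1, 1] * [(n - s.+1)%N, (t - 1)%N])
    <= 8 * R / 2 ^+ (n - 3 * t - s).
Proof.
move=> s_gt0 s_bd.
have le8 : [(t + s)%N, s] * [t.+1, 1] <= 8 * Q ^+ (t * s + t).
  rewrite exprD (_ : 8 * (Q ^+ (t * s) * Q ^+ t) = (4 * Q ^+ (t * s)) * (2 * Q ^+ t)).
    by rewrite ler_pM ?qbinom_ge0 ?qbinom_le4 ?qbinom1_le.
  by ring.
rewrite mulrA.
apply: (mul_le_absorb (e := n - 3 * t - s) _ _ le8); rewrite ?qbinom_ge0 //.
rewrite (_ : (t * s + t + (n - 3 * t - s) = (t - 1) * s + (n - 2 * t))%N).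
  by apply: qbinom_top_col; lia.
have : (t * s = (t - 1) * s + s)%N by rewrite mulnBl mul1n subnK // leq_pmull; lia.
by lia.
Qed.

End Estimates.
End GaussianBinomials.

(** * Counting subspaces and covering arguments *)

Section Counting.
Variables (K : finFieldType) (n : nat).
Local Notation V := 'rV[K]_n.
Local Notation q := #|K|.
Local Notation "[ m , k ]" := (qbinom q m k).
Implicit Types (U W S T D A B X : {vspace V}) (F G : {set {vspace V}}).

Let q_gt1 : (1 < q)%N. Proof. exact: finNzRing_gt1. Qed.

Definition subspaces_between S D k : {set {vspace V}} :=
  [set U | [&& (S <= U)%VS, (U <= D)%VS & \dim U == k]].

Lemma dim_fullv : \dim {:V} = n.
Proof. by rewrite dimvf /dim /= mul1n. Qed.

Lemma dim_leq U : (\dim U <= n)%N.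
Proof. by rewrite -[X in (_ <= X)%N]dim_fullv dimvS ?subvf. Qed.

Lemma dim_addv_line S (v : V) : v \notin S -> \dim (S + <[v]>) = (\dim S).+1.
Proof.
move=> vS; have v0 : v != 0 by apply: contraNneq vS => ->; rewrite mem0v.
have := dimv_sum_cap S <[v]>; rewrite dim_vline v0 addn1.
suff -> : \dim (S :&: <[v]>) = 0%N by rewrite addn0.
apply/eqP; rewrite dimv_eq0 -subv0; apply/subvP => w /memv_capP[wS /vlineP[c wE]].
rewrite memv0; apply: contraR vS => w0.
have c0 : c != 0 by apply: contraNneq w0 => c0; rewrite wE c0 scale0r.
by rewrite -[v](scalerK c0) -wE memvZ.
Qed.

Lemma card_vspaceD S U : (S <= U)%VS ->
  #|[pred v : V | (v \in U) && (v \notin S)]| = (q ^ \dim U - q ^ \dim S)%N.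
Proof.
move=> sSU; rewrite -!card_vspace -(cardID (mem S) (mem U)).
have -> : #|[predI mem U & mem S]| = #|S|.
  by apply: eq_card => v; rewrite !inE andb_idl //; apply: (subvP sSU).
by rewrite addKn; apply: eq_card => v; rewrite !inE andbC.
Qed.

(** Both sides count the pairs of a subspace [U] and a vector [v] of [U] outside [S]. *)
Lemma between_double_count S D k :
  (#|subspaces_between S D k| * (q ^ k - q ^ \dim S) =
   \sum_(v in [pred v : V | (v \in D) && (v \notin S)])
     #|subspaces_between (S + <[v]>) D k|)%N.
Proof.
rewrite -sum_nat_const.
have cardU U : U \in subspaces_between S D k ->
    (q ^ k - q ^ \dim S = \sum_(v : V | (v \in U) && (v \notin S)) 1)%N.
  rewrite inE => /and3P[sSU _ /eqP <-].
  by rewrite -card_vspaceD // -sum1_card; apply: eq_bigl => v; rewrite inE.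
rewrite (eq_bigr _ cardU).
under [RHS]eq_bigr do rewrite -sum1_card.
rewrite (exchange_big_dep (fun v : V => (v \in D) && (v \notin S))) /=.
  apply: eq_bigr => v /andP[vD vS]; apply: eq_bigl => U.
  rewrite !inE vS andbT subv_add -memvE.
  by case: (v \in U); rewrite ?andbF ?andbT.
move=> U v /[1!inE] /and3P[_ sUD _] /andP[vU ->]; rewrite andbT.
exact: (subvP sUD).
Qed.

(** By induction on [k - \dim S]: the double count, with each [S + <[v]>] one dimension larger, is
    the recursion [qbinomS]. *)
Lemma card_between S D k : (S <= D)%VS -> (\dim S <= k)%N ->
  #|subspaces_between S D k|%:R = [(\dim D - \dim S)%N, (k - \dim S)%N].
Proof.
move=> sSD leSk; move: {2}(k - \dim S)%N (erefl (k - \dim S)%N) => j.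
elim: j S sSD leSk => [|j IHj] S sSD leSk jE.
  rewrite jE qbinom0 (_ : subspaces_between S D k = [set S]) ?cards1 //.
  apply/setP => U; rewrite !inE; apply/and3P/eqP => [[sSU _ /eqP dU]|->].
    by apply/eqP; rewrite eq_sym eqEdim sSU dU; lia.
  by rewrite subvv sSD; split=> //; apply/eqP; lia.
have := between_double_count S D k.
move/(congr1 (fun x => x%:R : rat)); rewrite natrM natr_sum.
under eq_bigr => v /[1!inE] /andP[vD vS].
  rewrite IHj ?dim_addv_line //; [over | | lia | lia].
  by rewrite subv_add sSD -memvE.
rewrite sumr_const card_vspaceD // -[in RHS]mulr_natl => E.
have le1 : (q ^ \dim S <= q ^ k)%N by rewrite leq_exp2l.
have le2 : (q ^ \dim S <= q ^ \dim D)%N by rewrite leq_exp2l // dimvS.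
rewrite !natrB // !natrX in E.
have kE : k = (\dim S + j.+1)%N by lia.
have dE : \dim D = (\dim S + (\dim D - \dim S))%N by rewrite subnKC // dimvS.
rewrite jE qbinomS.
have s0 := Qexp_gt0 q_gt1 (\dim S); have j0 := QexpS_sub1_gt0 q_gt1 j.
rewrite mulrAC; apply: (canRL (mulfK _)); first by rewrite gt_eqF.
apply: (mulfI (lt0r_neq0 s0)).
have e1 : q%:R ^+ k = q%:R ^+ \dim S * q%:R ^+ j.+1 :> rat by rewrite -exprD -kE.
have e2 : q%:R ^+ \dim D = q%:R ^+ \dim S * q%:R ^+ (\dim D - \dim S) :> rat.
  by rewrite -exprD -dE.
rewrite e1 e2 in E.
have -> : (\dim D - \dim S).-1 = (\dim D - (\dim S).+1)%N by lia.
have -> : j = (k - (\dim S).+1)%N by lia.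
rewrite [RHS](_ : _ = (q%:R ^+ \dim S * q%:R ^+ (\dim D - \dim S) - q%:R ^+ \dim S)
  * [(\dim D - (\dim S).+1)%N, (k - (\dim S).+1)%N]); last by ring.
by rewrite -E (_ : (k - (\dim S).+1).+1 = j.+1); [ring | lia].
Qed.

Lemma between_nonempty S D k : (S <= D)%VS -> (\dim S <= k <= \dim D)%N ->
  exists U, [/\ (S <= U)%VS, (U <= D)%VS & \dim U = k].
Proof.
move=> sSD /andP[leSk lekD].
have : 0 < (#|subspaces_between S D k|%:R : rat).
  by rewrite card_between // qbinom_gt0 // leq_sub2r.
rewrite ltr0n card_gt0 => /set0Pn[U] /[1!inE] /and3P[? ? /eqP ?].
by exists U.
Qed.

Lemma card_bigcup_ler (I : finType) (J : {set I}) (E : I -> {set {vspace V}}) G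
    (c : rat) : (G \subset \bigcup_(i in J) E i) ->
  (forall i, i \in J -> #|E i|%:R <= c) -> #|G|%:R <= #|J|%:R * c.
Proof.
move=> /subset_leq_card sG leE.
have leU : (#|\bigcup_(i in J) E i| <= \sum_(i in J) #|E i|)%N.
  elim/big_rec2: _ => [|i m A _ leA]; first by rewrite cards0.
  by rewrite (leq_trans (leq_card_setU _ _)) // leq_add2l.
apply: (@le_trans _ _ (\sum_(i in J) #|E i|)%:R).
  by rewrite ler_nat (leq_trans sG).
by rewrite natr_sum mulr_natl -sumr_const ler_sum.
Qed.

(** Each member contains some [T] of dimension [\dim S + j] between [S] and [B :&: D]; the factors
    count the choices of [T] in [D] and the extensions of [T]. *)
Lemma card_cover S D k j G : (S <= D)%VS -> (\dim S + j <= k)%N ->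
    {in G, forall B, [/\ \dim B = k, (S <= B)%VS & \dim S + j <= \dim (B :&: D)]%N} ->
  #|G|%:R <= [(\dim D - \dim S)%N, j] * [(n - (\dim S + j))%N, (k - (\dim S + j))%N].
Proof.
move=> sSD le_k HG.
have <- : #|subspaces_between S D (\dim S + j)|%:R = [(\dim D - \dim S)%N, j] :> rat.
  by rewrite card_between ?leq_addr // addKn.
apply: (card_bigcup_ler (E := fun T => subspaces_between T fullv k)).
  apply/subsetP => B /HG[dB sSB le_cap].
  have [||T [sST sTB dT]] := @between_nonempty S (B :&: D) (\dim S + j).
  - by rewrite subv_cap sSB.
  - by rewrite leq_addr.
  move: sTB; rewrite subv_cap => /andP[sTB sTD].
  by apply/bigcupP; exists T; rewrite inE ?sST ?sTD ?dT ?sTB ?subvf ?dB eqxx.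
by move=> T /[1!inE] /and3P[_ _ /eqP dT]; rewrite card_between ?subvf ?dT // dim_fullv.
Qed.

(** The sum of [S] and [B :&: C] lies in [B :&: (S + C)], and these two meet in [S :&: C]. *)
Lemma dim_cap_addv_ge S B C : (S <= B)%VS ->
  (\dim (B :&: C) + \dim S <= \dim (B :&: (S + C)) + \dim (S :&: C))%N.
Proof.
move=> sSB; have := dimv_sum_cap S (B :&: C).
rewrite capvA (capv_idPl sSB) => E.
have : (S + B :&: C <= B :&: (S + C))%VS.
  by rewrite subv_add !subv_cap sSB addvSl capvSl (subv_trans (capvSr _ _)) ?addvSr.
by move/dimvS; lia.
Qed.

Definition intersecting k s G :=
  {in G, forall B, \dim B = k} /\ {in G &, forall A B, (s <= \dim (A :&: B))%N}.

(** Fix a member [A]. Every member contains an [s]-space [S] of [A]; since some member [C] misses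
    [S], those through [S] meet [S + C] in more than [S], which fixes one further dimension. *)
Lemma intersecting_bound t s G : (0 < t)%N -> intersecting (t + s) s G ->
    (forall S, \dim S = s -> exists2 C, C \in G & ~~ (S <= C)%VS) ->
  #|G|%:R <= [(t + s)%N, s] * ([t.+1, 1] * [(n - s.+1)%N, (t - 1)%N]).
Proof.
move=> t_gt0 [dG iG] Gs.
have [->|/set0Pn[A AG]] := eqVneq G set0.
  by rewrite cards0 !mulr_ge0 ?qbinom_ge0.
have <- : #|subspaces_between 0 A s|%:R = [(t + s)%N, s] :> rat.
  by rewrite card_between ?sub0v ?dimv0 // !subn0 dG.
apply: (card_bigcup_ler (E := fun S => [set B in G | (S <= B)%VS])).
  apply/subsetP => B BG.
  have [||S [_ sSAB dS]] := @between_nonempty 0 (A :&: B) s; rewrite ?sub0v //.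
    by rewrite dimv0 iG.
  move: sSAB; rewrite subv_cap => /andP[sSA sSB].
  by apply/bigcupP; exists S; rewrite !inE ?sub0v ?sSA ?dS ?eqxx ?BG.
move=> S /[1!inE] /and3P[_ sSA /eqP dS].
have [C CG nSC] := Gs S dS.
have ltSC : (\dim (S :&: C) < s)%N.
  rewrite -dS ltn_neqAle dimvS ?capvSl // andbT.
  apply: contra nSC => /eqP E; apply/capv_idPl/eqP.
  by rewrite eqEdim capvSl E leqnn.
have dSC := dimv_sum_cap S C; rewrite (dG _ CG) dS in dSC.
(* [D] replaces [S + C], whose dimension may exceed [(t + s).+1]: it costs no
   member [B], as the codimension of [D] is made up for in [B :&: (S + C)]. *)
have [||D [sSD sDSC dD]] := @between_nonempty S (S + C) (t + s).+1.
- exact: addvSl.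
- by rewrite dS; lia.
have -> : [t.+1, 1] = [(\dim D - \dim S)%N, 1] by congr qbinom; lia.
have -> : (n - s.+1 = n - (\dim S + 1))%N by lia.
have -> : (t - 1 = (t + s) - (\dim S + 1))%N by lia.
apply: card_cover => //; first by rewrite dS; lia.
move=> B /[1!inE] /andP[BG sSB]; split=> //; first exact: dG.
have H1 := dim_cap_addv_ge C sSB; have H2 := iG _ _ BG CG.
have H3 := dimv_sum_cap (B :&: (S + C)) D.
have : (B :&: (S + C) + D <= S + C)%VS by rewrite subv_add capvSr.
move/dimvS => H4.
have : (B :&: (S + C) :&: D <= B :&: D)%VS.
  by rewrite capvS ?subvv // capvSl.
by move/dimvS; lia.
Qed.

Lemma star_bound t s S G : \dim S = s ->
    {in G, forall B, \dim B = (t + s)%N /\ (S <= B)%VS} ->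
  #|G|%:R <= [(n - s)%N, t].
Proof.
move=> dS HG.
have := @card_between S fullv (t + s); rewrite subvf dS leq_addl addnK dim_fullv.
move=> <- //; rewrite ler_nat subset_leq_card //.
by apply/subsetP => B /HG[dB sSB]; rewrite inE sSB subvf dB eqxx.
Qed.

Lemma star_or_not s G :
  (exists2 S, \dim S = s & {in G, forall B, (S <= B)%VS}) \/
  (forall S, \dim S = s -> exists2 C, C \in G & ~~ (S <= C)%VS).
Proof.
case: (boolP [exists S : {vspace V}, (\dim S == s) && [forall B in G, (S <= B)%VS]]).
  move=> /existsP[S /andP[/eqP dS /forall_inP H]]; left; by exists S.
rewrite negb_exists => /forallP H; right=> S dS.
move: (H S); rewrite dS eqxx /= negb_forall => /existsP[C].
by rewrite negb_imply => /andP[CG nSC]; exists C.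
Qed.

End Counting.

(** * Families of bounded diameter, and balls around a line *)

Section CloseFamilies.
Variables (K : finFieldType) (n : nat).
Local Notation V := 'rV[K]_n.
Local Notation q := #|K|.
Local Notation "[ m , k ]" := (qbinom q m k).
Implicit Types (U W S T D A B X : {vspace V}) (F G : {set {vspace V}}).

(** The distance bound [2 * t], freed of truncated subtraction by means of [sdistE]. *)
Definition close t F :=
  {in F &, forall U W, (\dim U + \dim W <= 2 * \dim (U :&: W) + 2 * t)%N}.

Lemma sdistE U W : (sdist U W + 2 * \dim (U :&: W) = \dim U + \dim W)%N.
Proof.
have := dimv_sum_cap U W; rewrite /sdist.
have /dimvS : (U :&: W <= U + W)%VS by rewrite (subv_trans (capvSl _ _)) ?addvSl.
by lia.
Qed.

Lemma diam_close t F : (diam F <= 2 * t)%N -> close t F.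
Proof.
move=> /bigmax_leqP H U W UF WF; have /bigmax_leqP/(_ W WF) := H U UF.
by have := sdistE U W; lia.
Qed.

Lemma close_sub t F G : G \subset F -> close t F -> close t G.
Proof. by move=> /subsetP s H U W /s UF /s WF; apply: H. Qed.

Lemma card_dim_lt m : #|[set U : {vspace V} | (\dim U < m)%N]|%:R = \sum_(i < m) [n, i].
Proof.
elim: m => [|m IHm].
  by rewrite big_ord0 eq_card0 // => U; rewrite inE.
rewrite big_ord_recr /= -IHm.
have := @card_between _ _ 0%VS ({:V}%VS) m; rewrite sub0v dimv0 !subn0 dim_fullv.
move=> /(_ isT isT) <-; rewrite -natrD; congr (_%:R).
rewrite -(cardsID [set U : {vspace V} | (\dim U < m)%N] [set U : {vspace V} | (\dim U < m.+1)%N]).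
congr (_ + _)%N; apply: eq_card => U; rewrite !inE ?sub0v ?subvf /=; lia.
Qed.

(** Singles out the two levels at which a ball of radius [t] around a line is neither full nor
    empty. *)
Lemma card_split_dim t F :
  #|F| = (#|[set U in F | (\dim U < t)%N]| + #|[set U in F | \dim U == t]|
    + #|[set U in F | \dim U == t.+1]| + #|[set U in F | (t.+1 < \dim U)%N]|)%N.
Proof.
rewrite -(cardsID [set U : {vspace V} | (\dim U < t)%N] F) -!addnA; congr (_ + _)%N.
  by apply: eq_card => U; rewrite !inE.
rewrite -(cardsID [set U : {vspace V} | \dim U == t]); congr (_ + _)%N.
  by apply: eq_card => U; rewrite !inE; case: (U \in F); lia.
rewrite -(cardsID [set U : {vspace V} | \dim U == t.+1]); congr (_ + _)%N.
  by apply: eq_card => U; rewrite !inE; case: (U \in F); lia.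
by apply: eq_card => U; rewrite !inE; case: (U \in F); lia.
Qed.

(** The distance is [\dim A - 1] or [\dim A + 1], according to whether the line [X] lies in [A]. *)
Lemma mem_sball t A X : \dim X = 1%N ->
  (A \in sball X t) = (\dim A < t)%N || (X <= A)%VS && (\dim A <= t.+1)%N.
Proof.
move=> dX; rewrite inE; have := sdistE A X; rewrite dX.
case: (boolP (X <= A)%VS) => [/capv_idPr -> | nXA]; first by rewrite dX; lia.
suff -> : \dim (A :&: X) = 0%N by lia.
apply: contraNeq nXA => d0; apply/capv_idPr/eqP; rewrite eqEdim capvSr dX; lia.
Qed.

Lemma card_sball t X : (0 < t)%N -> \dim X = 1%N ->
  #|sball X t|%:R = \sum_(i < t) [n, i] + [(n - 1)%N, (t - 1)%N] + [(n - 1)%N, t].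
Proof.
move=> t_gt0 dX; rewrite (card_split_dim t) !natrD -card_dim_lt.
have cX k : (0 < k)%N -> #|subspaces_between X fullv k|%:R = [(n - 1)%N, (k - 1)%N].
  by move=> k_gt0; rewrite card_between ?subvf ?dX // dim_fullv.
rewrite -[in RHS](cX t) // (_ : [(n - 1)%N, t] = [(n - 1)%N, (t.+1 - 1)%N]); last by rewrite subSS subn0.
rewrite -(cX t.+1) // -[RHS]addr0; congr (_%:R + _%:R + _%:R + _).
- by apply: eq_card => U; rewrite inE mem_sball // inE; case: (X <= U)%VS; lia.
- by apply: eq_card => U; rewrite inE mem_sball // inE subvf; case: (X <= U)%VS; lia.
- by apply: eq_card => U; rewrite inE mem_sball // inE subvf; case: (X <= U)%VS; lia.
- apply/eqP; rewrite pnatr_eq0 cards_eq0; apply/eqP/setP => U.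
  by rewrite inE mem_sball // inE; case: (X <= U)%VS; lia.
Qed.

End CloseFamilies.

(** * Orthogonal complements *)

Section Duality.
Variables (K : finFieldType) (n : nat).
Local Notation V := 'rV[K]_n.
Variables (B : {biscalar V}) (B_nondeg : nondegenerate_form B).
Implicit Types (U W : {vspace V}) (F : {set {vspace V}}).

Lemma perpD U W : perp B (U + W) = (perp B U :&: perp B W)%VS.
Proof.
apply/vspaceP => v; rewrite memv_cap; apply/mem_perp/andP => [H|].
  split; apply/mem_perp => u uU; apply: H; first exact: (subvP (addvSl _ _)).
  exact: (subvP (addvSr _ _)).
case=> /mem_perp HU /mem_perp HW u /memv_addP[a aU [b bW ->]].
by rewrite linearDl HU // HW // addr0.
Qed.

(** The map [h] sends [u] to the coordinates of the functional [B u]. It is injective by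
    nondegeneracy on the left, hence onto, so testing [v] against preimages of the unit vectors
    kills every coordinate. *)
Lemma perp_fullv : perp B fullv = 0%VS.
Proof.
pose h (u : V) : V := \row_j B u (delta_mx 0 j).
have h_lin : linear h.
  by move=> a u v; apply/rowP => j; rewrite !mxE linearDl linearZl_LR.
pose hL : {linear V -> V} := HB.pack h (GRing.isLinear.Build K V V _ h h_lin).
have BE u v : B u v = \sum_j v 0 j * h u 0 j.
  rewrite {1}(row_sum_delta v) linear_sumr; apply: eq_bigr => j _.
  by rewrite linearZr_LR mxE.
have h_inj : lker (linfun hL) == 0%VS.
  apply/lker0P => u v; rewrite !lfunE /= => huv.
  apply/eqP; rewrite -subr_eq0; apply/eqP/B_nondeg => w.
  by rewrite linearBl !BE huv subrr.
apply/vspaceP => v; rewrite memv0; apply/idP/eqP => [/mem_perp vP | ->]; last exact: mem0v.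
apply/rowP => i; rewrite mxE.
have : delta_mx 0 i \in limg (linfun hL) by rewrite lker0_limgf // memvf.
case/memv_imgP => u _; rewrite lfunE /= => hu.
have := vP u (memvf _); rewrite BE (bigD1 i) //= -hu mxE !eqxx mulr1.
by rewrite big1 ?addr0 // => j ji; rewrite mxE (negPf ji) andbF mulr0.
Qed.

(** The orthogonal contains the intersection of the kernels given by a basis of [U], each of
    codimension at most 1. *)
Lemma dim_perp_geq U : (n <= \dim (perp B U) + \dim U)%N.
Proof.
pose ker u := lker (linfun (B u : V -> K^o)).
have dker u : (n <= (\dim (ker u)).+1)%N.
  have := limg_ker_dim (linfun (B u : V -> K^o)) fullv.
  rewrite capfv dim_fullv -/(ker u) => dk.
  have : (\dim (limg (linfun (B u : V -> K^o))) <= 1)%N.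
    by rewrite (leq_trans (dimvS (subvf _))) // dimvf.
  by lia.
have dseq (s : seq V) : (n <= \dim (\bigcap_(u <- s) ker u)%VS + size s)%N.
  elim: s => [|u s IHs]; first by rewrite big_nil dim_fullv leq_addr.
  rewrite big_cons /=; set W := (\bigcap_(_ <- s) _)%VS in IHs *.
  have := dimv_sum_cap (ker u) W; have := dker u.
  by have : (\dim (ker u + W) <= n)%N := dim_leq _; lia.
have := dseq (vbasis U); rewrite size_tuple => /leq_trans -> //.
rewrite leq_add2r dimvS //; apply/subvP => v vP; apply/mem_perp => u uU.
rewrite (coord_vbasis uU) linear_sumlz big1 // => i _.
rewrite linearZl_LR; suff -> : B (vbasis U)`_i v = 0 by rewrite mulr0.
apply/eqP; have : v \in ker (vbasis U)`_i.
  apply: (subvP _ _ vP); rewrite (big_rem (vbasis U)`_i) ?capvSl //.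
  by rewrite mem_nth // size_tuple.
by rewrite memv_ker lfunE.
Qed.

(* [dim_perp_geq] for [U] and for a complement of [U] add up to [n], which is
   also an upper bound since the two orthogonals meet trivially. *)
Lemma dim_perp U : \dim (perp B U) = (n - \dim U)%N.
Proof.
have := dim_perp_geq U; have := dim_perp_geq U^C; rewrite dimv_compl dim_fullv.
have := dimv_sum_cap (perp B U) (perp B U^C).
rewrite -perpD addv_complf perp_fullv dimv0.
by have : (\dim (perp B U + perp B U^C) <= n)%N := dim_leq _; have := dim_leq U; lia.
Qed.

(** If [U] and [W] have the same orthogonal, then so does [U + W], which therefore has the dimension
    of [W]. *)
Lemma perp_inj : injective (perp B).
Proof.
have sub U W : perp B U = perp B W -> (U <= W)%VS.
  move=> UW; have := dim_perp (U + W); rewrite perpD UW capvv dim_perp => d.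
  apply/addv_idPr/eqP; rewrite eq_sym eqEdim addvSr /=.
  by have : (\dim (U + W) <= n)%N := dim_leq _; have := dim_leq W; lia.
by move=> U W UW; apply/subv_anti; rewrite !sub.
Qed.

Lemma card_perp_family F : #|perp_family B F| = #|F|.
Proof. exact: card_imset perp_inj. Qed.

Lemma close_perp t F : close t F -> close t (perp_family B F).
Proof.
move=> cF _ _ /imsetP[U UF ->] /imsetP[W WF ->].
have := cF _ _ UF WF; rewrite -perpD !dim_perp.
have := dimv_sum_cap U W; have : (\dim (U + W) <= n)%N := dim_leq _.
by have := dim_leq U; have := dim_leq W; lia.
Qed.

End Duality.

(* The four terms stand for the members of dimension below [t], equal to [t],
   equal to [t + 1] and above [t + 1]. *)
Lemma sum4_lt (x1 x2 x3 x4 y r : rat) : 0 < r ->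
    x1 <= y -> x2 <= r / 256 -> x3 <= r / 16 -> x4 <= r * (2 / 4) + r / 4 ->
  x1 + x2 + x3 + x4 < y + r.
Proof. by lra. Qed.

(** * Bounds on levels and on the cases of the proof *)

Section LevelBounds.
Variables (K : finFieldType) (t n : nat).
Hypotheses (t_ge2 : (2 <= t)%N) (n_ge : (7 * t + 5 <= n)%N).
Local Notation V := 'rV[K]_n.
Local Notation q := #|K|.
Local Notation "[ m , k ]" := (qbinom q m k).
Local Notation R := [(n - 1)%N, t].
Implicit Types (U W S T D A X : {vspace V}) (F G : {set {vspace V}}).

Let q_gt1 : (1 < q)%N. Proof. exact: finNzRing_gt1. Qed.

Let R_gt0 : 0 < R. Proof. by apply: qbinom_gt0 => //; lia. Qed.

Lemma close_intersecting s G : close t G -> {in G, forall U, \dim U = (t + s)%N} ->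
  intersecting (t + s) s G.
Proof.
move=> cG dG; split=> // A B AG BG.
by have := cG _ _ AG BG; rewrite (dG _ AG) (dG _ BG); lia.
Qed.

(** The two summands are the star and non-star bounds; adding them avoids carrying the alternative
    through the sum over levels. *)
Lemma level_bound s G : (0 < s)%N -> (2 * (t + s) <= n)%N -> close t G ->
    {in G, forall U, \dim U = (t + s)%N} ->
  #|G|%:R <= R / 4 ^+ (s - 1) + 8 * R / 2 ^+ (n - 3 * t - s).
Proof.
move=> s_gt0 s_le cG dG.
have x_ge0 : 0 <= R / 4 ^+ (s - 1) by rewrite divr_ge0 ?exprn_ge0 // ltW.
have y_ge0 : 0 <= 8 * R / 2 ^+ (n - 3 * t - s).
  by apply: divr_ge0; [apply: mulr_ge0 (ltW R_gt0) | apply: exprn_ge0].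
have [[S dS sG] | nostar] := star_or_not s G.
  apply: (@le_trans _ _ (R / 4 ^+ (s - 1))); last by rewrite lerDl.
  apply: (le_trans (star_bound (t := t) dS _)) => [B BG|].
    by rewrite dG // sG.
  by apply: star_estimate => //; lia.
apply: (@le_trans _ _ (8 * R / 2 ^+ (n - 3 * t - s))); last by rewrite lerDr.
apply: (le_trans (intersecting_bound (t := t) _ (close_intersecting cG dG) nostar)); first lia.
by apply: nonstar_estimate => //; lia.
Qed.

(** Both geometric sums are put in a form that fits induction on [b]: [2 / 4 ^ (b - 1) - 2 / 4 ^ b]
    exceeds [1 / 4 ^ (b - 1)], and [2 ^ b + 2 ^ b = 2 ^ b.+1]. *)
Lemma levels_bound a b G : (0 < a <= b)%N -> (2 * (t + b) <= n + 2)%N -> close t G ->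
    {in G, forall U, t + a <= \dim U < t + b}%N ->
  #|G|%:R <= R * (2 / 4 ^+ (a - 1) - 2 / 4 ^+ (b - 1)) + 8 * R * 2 ^+ b / 2 ^+ (n - 3 * t).
Proof.
case/andP=> a_gt0; elim: b G => [|b IHb] G le_ab b_le cG dG; first by lia.
have [ab|ab] := eqVneq a b.+1.
  rewrite (_ : G = set0); last first.
    by apply/setP => U; rewrite in_set0; apply/negP => /dG; lia.
  rewrite cards0 ab subrr mulr0 add0r; apply: divr_ge0; last exact: exprn_ge0.
  by apply: mulr_ge0; [apply: mulr_ge0 (ltW R_gt0) | apply: exprn_ge0].
rewrite -(cardsID [set U : {vspace V} | (\dim U < t + b)%N] G) natrD.
have le1 := IHb (G :&: [set U : {vspace V} | (\dim U < t + b)%N]).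
have {}le1 := le1 ltac:(lia) ltac:(lia) (close_sub (subsetIl _ _) cG).
have {}le1 := le1 ltac:(by move=> U; rewrite !inE => /andP[/dG]; lia).
have le2 := @level_bound b (G :\: [set U : {vspace V} | (\dim U < t + b)%N]).
have {}le2 := le2 ltac:(lia) ltac:(lia) (close_sub (subsetDl _ _) cG).
have {}le2 := le2 ltac:(by move=> U; rewrite !inE => /andP[? /dG]; lia).
apply: (le_trans (lerD le1 le2)).
have -> : (b.+1 - 1 = (b - 1).+1)%N by lia.
have e1 : 2 ^+ (n - 3 * t) = 2 ^+ (n - 3 * t - b) * 2 ^+ b :> rat.
  by rewrite -exprD; congr (_ ^+ _); lia.
rewrite e1 invfM !exprS invfM.
have p0 : 2 ^+ b != 0 :> rat by rewrite expf_neq0.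
have y0 : 0 < 4 ^- (b - 1) :> rat by rewrite invr_gt0 exprn_gt0.
have E x : 8 * R * x * (2 ^- (n - 3 * t - b) * 2 ^- b)
   = (8 * R / 2 ^+ (n - 3 * t - b)) * (x / 2 ^+ b) by ring.
rewrite (E (2 ^+ b)) (E (2 * 2 ^+ b)) mulfK // divff // mulr1.
have Ry : 0 < R * 4 ^- (b - 1) by rewrite mulr_gt0.
move: Ry; set y := 4 ^- (b - 1); set w := _ / 2 ^+ _; set z := 4 ^- (a - 1).
by clearbody y w z; clear -K; move: R => r Ry; lra.
Qed.

Lemma low_bound a G : (0 < a)%N -> close t G ->
    {in G, forall U, t + a <= \dim U /\ 2 * \dim U <= n}%N ->
  #|G|%:R <= R * (2 / 4 ^+ (a - 1)) + R / 4.
Proof.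
move=> a_gt0 cG dG.
have [->|/set0Pn[U0 U0G]] := eqVneq G set0.
  have := R_gt0; have : 0 < 4 ^- (a - 1) :> rat by rewrite invr_gt0 exprn_gt0.
  by rewrite cards0; set y := 4 ^- _ => y_gt0 R0; nra.
have [d1 d2] := dG _ U0G.
(* With this [b], [t + b] is the first dimension above [n / 2]. *)
have [b bdef] : exists b, b = (n./2 - t + 1)%N by eexists.
have bE : (2 * (t + b) <= n + 2)%N by lia.
have ab : (0 < a <= b)%N by lia.
have dG' : {in G, forall U, t + a <= \dim U < t + b}%N.
  by move=> U /dG[]; lia.
apply: (le_trans (levels_bound ab bE cG dG')).
(* The spare exponent 5 turns the constant 8 into [8 / 2 ^ 5 = 1 / 4]. *)
have -> : (n - 3 * t = b + 5 + (n - 3 * t - b - 5))%N by lia.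
rewrite !exprD !invfM.
have p0 : 2 ^+ b != 0 :> rat by rewrite expf_neq0.
set w := 2 ^- (_ - _ - _ - _).
have w_le1 : w <= 1 by rewrite invf_le1 ?exprn_gt0 // exprn_ege1.
have y0 : 0 <= 4 ^- (b - 1) :> rat by rewrite invr_ge0 exprn_ge0.
rewrite (_ : 8 * R * 2 ^+ b * (2 ^- b * 2 ^- 5 * w) = R / 4 * w * (2 ^+ b / 2 ^+ b)).
  rewrite divff // mulr1; apply: lerD.
    by rewrite ler_pM2l // gerBl mulr_ge0.
  by rewrite ler_piMr // divr_ge0 // ltW.
by move: p0; set p := 2 ^+ b => p0; rewrite !exprS expr0; field.
Qed.

(** Closeness to [A], of dimension above [t], forces every [t]-dimensional member to contain a line
    of [A]. *)
Lemma level_t_bound F A : close t F -> A \in F -> (t < \dim A <= 3 * t + 1)%N ->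
  #|[set U in F | \dim U == t]|%:R <= R / 256.
Proof.
move=> cF AF dA.
apply: le_trans (cover1_estimate q_gt1 t_ge2 n_ge (a := \dim A) _); last by lia.
have := @card_cover _ _ 0%VS A t 1 [set U in F | \dim U == t].
rewrite dimv0 !add0n !subn0; apply; [exact: sub0v | lia |].
move=> U /[1!inE] /andP[UF /eqP dU]; rewrite dU sub0v; split=> //.
by have := cF _ _ UF AF; lia.
Qed.

(** The planes of [D] cover this level. [D] will be either a member or the sum of a line and a
    member. *)
Lemma level_tS_bound D F : (1 < \dim D <= 3 * t + 1)%N ->
    {in F, forall U, \dim U = t.+1 -> (1 < \dim (U :&: D))%N} ->
  #|[set U in F | \dim U == t.+1]|%:R <= R / 16.
Proof.
move=> dD H.
apply: le_trans (cover2_estimate q_gt1 t_ge2 n_ge (a := \dim D) _); last by lia.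
have := @card_cover _ _ 0%VS D t.+1 2 [set U in F | \dim U == t.+1].
rewrite dimv0 !add0n !subn0 (_ : t.+1 - 2 = t - 1)%N; last lia.
apply; [exact: sub0v | lia |].
by move=> U /[1!inE] /andP[UF /eqP dU]; rewrite dU sub0v; split=> //; apply: H.
Qed.

Lemma low_case F U0 A : close t F -> U0 \in F -> (\dim U0 <= t.+1)%N ->
    A \in F -> (t < \dim A)%N ->
  #|F|%:R < \sum_(i < t) [n, i] + R \/
  exists2 X, \dim X = 1%N & F \subset sball X t.
Proof.
move=> cF U0F dU0 AF dA.
(* Closeness gives [\dim U <= \dim U0 + 2 * t], as the meet has dimension at most [\dim U0]. *)
have dF U : U \in F -> (\dim U <= 3 * t + 1)%N.
  move=> UF; have := cF _ _ UF U0F.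
  by have := dimvS (capvSr U U0); lia.
have le_lt : #|[set U in F | (\dim U < t)%N]|%:R <= \sum_(i < t) [n, i].
  rewrite -card_dim_lt ler_nat subset_leq_card //.
  by apply/subsetP => U; rewrite !inE => /andP[].
have le_t : #|[set U in F | \dim U == t]|%:R <= R / 256.
  by apply: (level_t_bound cF AF); have := dF _ AF; lia.
have {le_lt le_t}conclude : #|[set U in F | \dim U == t.+1]|%:R <= R / 16 ->
    #|[set U in F | (t.+1 < \dim U)%N]|%:R <= R * (2 / 4) + R / 4 ->
    #|F|%:R < \sum_(i < t) [n, i] + R.
  move=> le1 le2; rewrite (card_split_dim t) !natrD.
  exact: sum4_lt R_gt0 le_lt le_t le1 le2.
have [/existsP[D /andP[DF dD]] | noD] :=
    boolP [exists D : {vspace V}, (D \in F) && (t.+1 < \dim D)%N].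
  left; apply: conclude.
  - apply: (@level_tS_bound D); first by rewrite dF // andbT; lia.
    by move=> U UF dU; have := cF _ _ UF DF; lia.
  - have := @low_bound 2 [set U in F | (t.+1 < \dim U)%N] isT.
    rewrite expr1; apply.
      by apply: close_sub cF; apply/subsetP => U /[1!inE] /andP[].
    by move=> U /[1!inE] /andP[/dF]; lia.
have {noD}dF' U : U \in F -> (\dim U <= t.+1)%N.
  move=> UF; move: noD; rewrite negb_exists => /forallP/(_ U).
  by rewrite UF /= -leqNgt.
have le_gt : #|[set U in F | (t.+1 < \dim U)%N]|%:R <= R * (2 / 4) + R / 4.
  rewrite eq_card0 => [|U]; first by apply: addr_ge0; apply: mulr_ge0 (ltW R_gt0) _.
  by rewrite inE; apply/negP => /andP[/dF']; lia.
have {conclude le_gt}conclude := conclude^~ le_gt.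
have [[X dX sX] | nostar] := star_or_not 1 [set U in F | \dim U == t.+1].
  (* If a [t]-dimensional [D] avoids [X], each [U] of level [t + 1] contains [X] and meets [D],
     hence meets [X + D] in at least a plane. If there is no such [D], the family lies in the ball
     around [X]. *)
  have [/existsP[D /and3P[DF dD nXD]] | noD] :=
      boolP [exists D : {vspace V}, [&& D \in F, \dim D == t & ~~ (X <= D)%VS]].
    left; apply: conclude.
    have capXD : \dim (X :&: D) = 0%N.
      apply: contraNeq nXD => c0; apply/capv_idPl/eqP.
      by rewrite eqEdim capvSl dX; lia.
    have dXD := dimv_sum_cap X D.
    apply: (@level_tS_bound (X + D)%VS); first by lia.
    move=> U UF dU; have sXU : (X <= U)%VS by apply: sX; rewrite inE UF dU eqxx.
    have := dim_cap_addv_ge D sXU; have := cF _ _ UF DF.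
    by lia.
  right; exists X => //; apply/subsetP => U UF; rewrite mem_sball //.
  have dU := dF' _ UF.
  have sXU : (t <= \dim U)%N -> (X <= U)%VS.
    move=> dUt; have [dUS | dUS] := eqVneq (\dim U) t.+1.
      by apply: sX; rewrite inE UF dUS eqxx.
    move: noD; rewrite negb_exists => /forallP/(_ U); rewrite UF /= negb_and negbK.
    by case/orP=> //; lia.
  by rewrite dU andbT; case: (leqP t (\dim U)) => [/sXU -> | //]; rewrite orbT.
left; apply: conclude.
have iG1 : intersecting (t + 1) 1 [set U in F | \dim U == t.+1].
  apply: close_intersecting => [|U /[1!inE] /andP[_ /eqP ->]]; last by rewrite addn1.
  by apply: close_sub cF; apply/subsetP => U /[1!inE] /andP[].
apply: (le_trans (intersecting_bound _ iG1 nostar)); first lia.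
apply: (le_trans (nonstar_estimate q_gt1 t_ge2 n_ge _ _)) => //; first lia.
(* Seven factors of 2 suffice: [8 / 2 ^ 7 = 1 / 16]. *)
have -> : (n - 3 * t - 1 = 7 + (n - 3 * t - 8))%N by lia.
rewrite exprD invfM.
set w := 2 ^- (_ - _ - _).
have w_le1 : w <= 1 by rewrite invf_le1 ?exprn_gt0 // exprn_ege1.
rewrite (_ : 8 * R * _ = R / 16 * w).
  by apply: ler_piMr w_le1; apply: mulr_ge0 (ltW R_gt0) _.
by rewrite !exprS expr0; field.
Qed.

Variables (B : {biscalar V}) (B_nondeg : nondegenerate_form B).

Lemma high_bound a F : (0 < a)%N -> close t F ->
    {in F, forall U, \dim U + (t + a) <= n /\ n <= 2 * \dim U}%N ->
  #|F|%:R <= R * (2 / 4 ^+ (a - 1)) + R / 4.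
Proof.
move=> a_gt0 cF dF; rewrite -(card_perp_family B_nondeg).
apply: low_bound => //; first exact: close_perp.
move=> _ /imsetP[U UF ->]; rewrite dim_perp //.
by have := dF _ UF; lia.
Qed.

(** Dimensions differ by at most [2 * t]. A member of dimension [t + 2] keeps all of them below the
    middle, giving [3 / 4 * R]; dually for [n - t - 2]. Otherwise each half starts one level further
    in and has at most [3 / 8 * R] members. *)
Lemma middle_case F : close t F ->
  {in F, forall U, t.+1 < \dim U /\ \dim U + t.+1 < n}%N -> #|F|%:R < R.
Proof.
move=> cF dF.
have window U W : U \in F -> W \in F -> (\dim U <= \dim W + 2 * t)%N.
  by move=> UF WF; have := cF _ _ UF WF; have := dimvS (capvSr U W); lia.
have [/existsP[D /andP[DF /eqP dD]] | noD] :=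
    boolP [exists D : {vspace V}, (D \in F) && (\dim D == t.+2)].
  apply: (le_lt_trans (@low_bound 2 F isT cF _)); last by have := R_gt0; rewrite expr1; lra.
  by move=> U UF; have := dF _ UF; have := window _ _ UF DF; lia.
have [/existsP[D /andP[DF /eqP dD]] | noE] :=
    boolP [exists D : {vspace V}, (D \in F) && (\dim D == n - t.+2)%N].
  apply: (le_lt_trans (@high_bound 2 F isT cF _)); last by have := R_gt0; rewrite expr1; lra.
  by move=> U UF; have := dF _ UF; have := window _ _ DF UF; lia.
have dF' U : U \in F -> (t.+2 < \dim U /\ \dim U + t.+2 < n)%N.
  move=> UF; have := dF _ UF.
  move: noD noE; rewrite !negb_exists => /forallP/(_ U) + /forallP/(_ U).
  by rewrite UF /=; lia.
rewrite -(cardsID [set U : {vspace V} | (2 * \dim U <= n)%N] F) natrD.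
have lo := @low_bound 3 (F :&: [set U : {vspace V} | (2 * \dim U <= n)%N]) isT.
have {}lo := lo (close_sub (subsetIl _ _) cF).
have {}lo := lo ltac:(by move=> U; rewrite !inE => /andP[/dF']; lia).
have hi := @high_bound 3 (F :\: [set U : {vspace V} | (2 * \dim U <= n)%N]) isT.
have {}hi := hi (close_sub (subsetDl _ _) cF).
have {}hi := hi ltac:(by move=> U; rewrite !inE => /andP[? /dF']; lia).
move: R_gt0 lo hi; rewrite !exprS expr0.
by set x := #|_|%:R; set y := #|_|%:R; lra.
Qed.

End LevelBounds.

(** * Assembly of the bound and the equality case *)

Lemma mem_bigcup_dim (K : finFieldType) (n a b : nat) (A : {vspace 'rV[K]_n}) :
  (a <= \dim A < b)%N -> A \in \bigcup_(a <= k < b) subspaces_of_dim K n k.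
Proof.
move=> dA; rewrite (bigD1_seq (\dim A)) ?mem_index_iota ?iota_uniq //=.
by rewrite !inE eqxx.
Qed.

Theorem theorem1p3 (K : finFieldType) (t n : nat)
    (ht : (2 <= t)%N) (hn : (7 * t + 5 <= n)%N)
    (B : {biscalar 'rV[K]_n}) (hB : nondegenerate_form B)
    (Fam : {set {vspace 'rV[K]_n}})
    (hdiam : (diam Fam <= 2 * t)%N)
    (hlow : ~~ (Fam \subset subspaces_low K n t))
    (hhigh : ~~ (Fam \subset subspaces_high K n t)) :
  let q := #|K| in
  let bound : rat :=
    \sum_(i < t) qbinom q n i + qbinom q (n - 1) (t - 1) + qbinom q (n - 1) t in
  #|Fam|%:R <= bound /\
  (#|Fam|%:R = bound <->
   exists X : {vspace 'rV[K]_n},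
     \dim X = 1%N /\ (Fam = sball X t \/ perp_family B Fam = sball X t)).
Proof.
move=> q bound.
have cF := diam_close hdiam.
have [A AF nA] := subsetPn hlow; have [C CF nC] := subsetPn hhigh.
have dA : (t < \dim A)%N.
  by rewrite ltnNge; apply: contra nA => dA; apply: mem_bigcup_dim; rewrite ltnS.
have dC : (\dim C < n - t)%N.
  rewrite ltnNge; apply: contra nC => dC; apply: mem_bigcup_dim.
  by rewrite dC ltnS dim_leq.
have q_gt1 : (1 < q)%N by apply: finNzRing_gt1.
have lt_bound (x : rat) : x < \sum_(i < t) qbinom q n i + qbinom q (n - 1) t -> x < bound.
  move/lt_le_trans; apply; rewrite lerD2r lerDl; exact: qbinom_ge0.
(* Strict inequality or inclusion in a ball yields both claims, since the ball has exactly [bound]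
   elements. *)
have dich : #|Fam|%:R < bound \/ exists X : {vspace 'rV[K]_n},
    \dim X = 1%N /\ (Fam \subset sball X t \/ perp_family B Fam \subset sball X t).
  have [/existsP[U /andP[UF dU]] | noU] :=
      boolP [exists U : {vspace 'rV[K]_n}, (U \in Fam) && (\dim U <= t.+1)%N].
    have [lt | [X dX sX]] := low_case ht hn cF UF dU AF dA; last by right; exists X; auto.
    by left; apply: lt_bound.
  have [/existsP[U /andP[UF dU]] | noW] :=
      boolP [exists U : {vspace 'rV[K]_n}, (U \in Fam) && (n <= \dim U + t.+1)%N].
    (* In the dual family [perp B C] plays the part that [A] had above. *)
    have dU' : (\dim (perp B U) <= t.+1)%N by rewrite dim_perp //; lia.
    have dC' : (t < \dim (perp B C))%N by rewrite dim_perp //; lia.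
    have [lt | [X dX sX]] := low_case ht hn (close_perp hB cF)
      (imset_f _ UF) dU' (imset_f _ CF) dC'; last by right; exists X; auto.
    by left; apply: lt_bound; rewrite -(card_perp_family hB).
  left; apply: lt_bound.
  have lt_R : #|Fam|%:R < qbinom q (n - 1) t.
    apply: (middle_case ht hn hB cF) => U UF.
    move: noU noW; rewrite !negb_exists => /forallP/(_ U) + /forallP/(_ U).
    by rewrite UF /= -!ltnNge.
  apply: lt_le_trans lt_R _; rewrite lerDr; apply: sumr_ge0 => i _.
  exact: qbinom_ge0.
have card_ball (X : {vspace 'rV[K]_n}) : \dim X = 1%N -> #|sball X t|%:R = bound.
  by move=> dX; exact: card_sball (ltnW ht) dX.
split.
  case: dich => [/ltW // | [X [dX]]]; rewrite -(card_ball X dX) ler_nat.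
  by case=> /subset_leq_card //; rewrite card_perp_family.
split=> [cardF | [X [dX]]]; last first.
  by rewrite -(card_ball X dX) => -[<- // | <-]; rewrite card_perp_family.
case: dich => [| [X [dX sX]]]; first by rewrite cardF ltxx.
exists X; split=> //.
have cFX : #|Fam| = #|sball X t|.
  by apply/eqP; rewrite -(eqr_nat rat) cardF card_ball.
case: sX => sX; [left | right]; apply/eqP; rewrite eqEcard sX.
  by rewrite cFX leqnn.
by rewrite card_perp_family // cFX leqnn.
Qed.
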